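(* Let $(\mathcal M,[\,,\,],\langle\,,\,\rangle)$ be a quadratic Malcev algebra over $\mathbb K$. Then $(\mathcal M,[\,,\,],\langle\,,\,\rangle)$ is flat if and only if $(\mathcal M,[\,,\,])$ is $3$-step nilpotent.
   Context: $\mathbb K$ is a field of characteristic zero; vector spaces are finite dimensional. A Malcev algebra is a vector space $\mathcal M$ with an anti-symmetric bilinear bracket satisfying $J(u,v,[u,w])=[J(u,v,w),u]$, where $J(u,v,w)=[[u,v],w]+[[w,u],v]+[[v,w],u]$. It is quadratic if endowed with a non-degenerate symmetric bilinear form $\langle\,,\,\rangle$ such that $\langle[u,v],w\rangle+\langle v,[u,w]\rangle=0$ for all $u,v,w$. The Levi-Civita product $\bullet$ is defined by $2\langle u\bullet v,w\rangle=\langle[u,v],w\rangle-\langle[v,w],u\rangle+\langle[w,u],v\rangle$; $\mathrm L_u(v)=u\bullet v$. The algebra is flat if $K=0$, where $$K(u,v,w)=\mathrm L_{[[u,v],w]}-\mathrm L_{[u,w]}\circ\mathrm L_v-\mathrm L_u\circ\mathrm L_{[v,w]}+\mathrm L_v\circ\mathrm L_u\circ\mathrm L_w-\mathrm L_w\circ\mathrm L_v\circ\mathrm L_u.$$ Here ''$3$-step nilpotent'' means nilpotent of class at most three, i.e. $[[[u,v],w],z]=0$ for all $u,v,w,z\in\mathcal M$. *)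

(* Defs.v *)
From HB Require Import structures.
From mathcomp Require Import all_boot all_algebra ring.

Set Implicit Arguments.
Unset Strict Implicit.
Unset Printing Implicit Defensive.

Import GRing.Theory.
Local Open Scope ring_scope.

Section MalcevAlgebra.
Variables (K : fieldType) (M : vectType K) (br : {bilinear M -> M -> M}).

Definition jacobiator (u v w : M) : M :=
  br (br u v) w + br (br w u) v + br (br v w) u.

(* antisymmetry is [u, v] = - [v, u]; over characteristic 2 this would not
   force [u, u] = 0, but only characteristic 0 is considered *)
Definition is_malcev : Prop :=
  (forall u v, br u v = - br v u) /\
  (forall u v w, jacobiator u v (br u w) = br (jacobiator u v w) u).

Definition three_step_nilpotent : Prop :=
  forall u v w z, br (br (br u v) w) z = 0.

End MalcevAlgebra.

Section QuadraticMalcev.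
Variables (K : fieldType) (M : vectType K).
Variables (br : {bilinear M -> M -> M}) (form : {symmetric M}).

Definition is_quadratic_malcev : Prop :=
  [/\ is_malcev br, nondegenerate form
    & forall u v w, form (br u v) w + form v (br u w) = 0].

Definition musical : 'Hom(M, 'Hom(M, K^o)) :=
  linfun (fun u => linfun (form u : M -> K^o)).

Definition koszul (u v w : M) : K :=
  form (br u v) w - form (br v w) u + form (br w u) v.

(* u . v is the vector representing the linear form 1/2 koszul u v, obtained
   through the inverse of the isomorphism u |-> form u; it is characterized by
   its defining identity, see levi_civitaP and levi_civita_unique *)
Definition levi_civita (u v : M) : M :=
  (musical^-1)%VF (linfun (fun w => 2^-1 * koszul u v w : K^o)).

Definition levi_civita_left (u : M) : 'End(M) := linfun (levi_civita u).

Definition curvature (u v w : M) : 'End(M) :=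
  let L := levi_civita_left in
  (L (br (br u v) w) - (L (br u w) \o L v) - (L u \o L (br v w))
   + (L v \o L u \o L w) - (L w \o L v \o L u))%VF.

Definition is_flat : Prop := forall u v w, curvature u v w = 0.

Let formPl a x y w : form (a *: x + y) w = a * form x w + form y w.
Proof. by rewrite linearPl. Qed.

Let formPr a x y u : form u (a *: x + y) = a * form u x + form u y.
Proof. by rewrite linearPr. Qed.

Let brPl a x y w : br (a *: x + y) w = a *: br x w + br y w.
Proof. by rewrite linearPl. Qed.

Let brPr a x y u : br u (a *: x + y) = a *: br u x + br u y.
Proof. by rewrite linearPr. Qed.

Let linfun_formE u w : linfun (form u : M -> K^o) w = form u w.
Proof. by rewrite lfunE. Qed.

Let musical_linear : linear (fun u => linfun (form u : M -> K^o)).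
Proof.
move=> a x y; apply/lfunP=> z; rewrite add_lfunE scale_lfunE !linfun_formE.
exact: formPl.
Qed.

Lemma musicalE u w : musical u w = form u w.
Proof.
pose f := GRing.isLinear.Build K M _ _ _ musical_linear.
pose F : {linear M -> 'Hom(M, K^o)} :=
  HB.pack (fun u => linfun (form u : M -> K^o)) f.
by rewrite /musical (lfunE F) linfun_formE.
Qed.

Let koszul_linear u v : linear (fun w => 2^-1 * koszul u v w : K^o).
Proof.
move=> a x y; rewrite /koszul !(formPr, brPl, brPr, formPl).
rewrite /GRing.scale /=; ring.
Qed.

Lemma koszul_linfunE u v w :
  linfun (fun w => 2^-1 * koszul u v w : K^o) w = 2^-1 * koszul u v w.
Proof.
pose f := GRing.isLinear.Build K M _ _ _ (koszul_linear u v).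
pose F : {linear M -> K^o} := HB.pack (fun w => 2^-1 * koszul u v w : K^o) f.
by rewrite (lfunE F).
Qed.

Lemma levi_civita_linear u : linear (levi_civita u).
Proof.
move=> a x y; rewrite /levi_civita -linearP; congr (_ _); apply/lfunP=> w.
rewrite add_lfunE scale_lfunE !koszul_linfunE.
rewrite /koszul !(formPr, brPl, brPr, formPl) /GRing.scale /=; ring.
Qed.

Lemma levi_civita_leftE u v : levi_civita_left u v = levi_civita u v.
Proof.
pose f := GRing.isLinear.Build K M _ _ _ (levi_civita_linear u).
pose F : {linear M -> M} := HB.pack (levi_civita u) f.
by rewrite /levi_civita_left (lfunE F).
Qed.

Hypothesis nd : nondegenerate form.

Lemma nondegenerate_inj u : (forall w, form u w = 0) -> u = 0.
Proof.
move=> fu0; apply/eqP; rewrite -memv0 -(eqP nd).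
by apply/mem_orthovP=> v _.
Qed.

Lemma musicalVK : cancel (musical^-1)%VF musical.
Proof.
have inj : lker musical == 0%VS.
  apply/eqP/vspaceP=> u; rewrite memv0 memv_ker; apply/eqP/eqP=> [fu0|->].
    by apply: nondegenerate_inj => w; rewrite -musicalE fu0 lfunE.
  by rewrite linear0.
move=> f; apply: limg_lfunVK; suff -> : limg musical = fullv by rewrite memvf.
apply/eqP; rewrite eqEdim subvf limg_dim_eq ?(eqP inj) ?capv0 //.
by rewrite !dimvf /dim /= muln1.
Qed.

Lemma levi_civitaP (char0 : [pchar K] =i pred0) u v w :
  2 * form (levi_civita u v) w =
  form (br u v) w - form (br v w) u + form (br w u) v.
Proof.
rewrite -musicalE musicalVK koszul_linfunE mulrA divff ?mul1r //.
by rewrite ((pcharf0P K).1 char0).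
Qed.

Lemma levi_civita_unique (char0 : [pchar K] =i pred0) u v x :
  (forall w, 2 * form x w =
     form (br u v) w - form (br v w) u + form (br w u) v) ->
  x = levi_civita u v.
Proof.
move=> xP; apply/eqP; rewrite -subr_eq0; apply/eqP/nondegenerate_inj => w.
have two0 : 2 != 0 :> K by rewrite ((pcharf0P K).1 char0).
by apply: (mulfI two0); rewrite linearBl mulrBr xP levi_civitaP // subrr mulr0.
Qed.

End QuadraticMalcev.

(* Main.v *)
Require Import Defs.
From mathcomp Require Import all_boot all_algebra.
From mathcomp Require Import ring.

Import GRing.Theory.
Local Open Scope ring_scope.

(** Write [abcd] for [[[a,b],c],d]. Invariance of the form makes the trilinear
    map <[u,v],w> alternating, so the three terms of the Koszul formula coincide
    up to sign and the Levi-Civita product is half the bracket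
    ([levi_civita_half_bracket]). Substituting this into the curvature and
    using antisymmetry to make the words left-normed, flatness becomes the
    identity ([curvature_words])

      4 [uvwz] + 2 [vwzu] + [wzuv] + [zuvw] = 2 [[u,w],[v,z]].

    If the class is at most three, the words vanish, and so does the right-hand
    side, because <[[u,w],[v,z]],x> is, by invariance, <z, [v,[[u,w],x]]>, up
    to sign the product of z with a word of length four
    ([double_bracket_eq0]).

    Conversely, the right-hand side is unchanged by the cyclic shift
    u -> v -> w -> z -> u. Flatness thus says that a circulant matrix with
    first row (4, 2, 1, 1) sends the four cyclic shifts of [uvwz] to a constant
    vector. This matrix is invertible (its eigenvalues are 8, 2 and 3 + i, 3 - i),
    hence the shifts are all equal ([flat_word_cyclic]). But [uvwz] also changes
    sign when u and v are exchanged. This transposition and the 4-cycle generate the symmetric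
    group, which would therefore act on the word by a linear character equal
    to -1 on transpositions and to 1 on an odd permutation; so [uvwz] = 0
    ([antisym_cyclic_eq0]). *)

(** The coefficients (7, -9, 3, -1) / 20 are the difference of the first two rows
    of the inverse of the circulant matrix with first row (4, 2, 1, 1). All rows
    of this inverse have the same sum, so s cancels. *)
Lemma circulant_eq {K : fieldType} (char0 : [pchar K] =i pred0)
  (a b c d s : K) :
  4 * a + 2 * b + c + d - s = 0 -> 4 * b + 2 * c + d + a - s = 0 ->
  4 * c + 2 * d + a + b - s = 0 -> 4 * d + 2 * a + b + c - s = 0 ->
  a = b.
Proof.
move=> Ea Eb Ec Ed.
have n20 : 20%:R != 0 :> K by rewrite ((pcharf0P K).1 char0).
apply/eqP; rewrite -subr_eq0; apply/eqP; apply: (mulfI n20); rewrite mulr0.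
transitivity (7 * (4 * a + 2 * b + c + d - s)
  - 9 * (4 * b + 2 * c + d + a - s) + 3 * (4 * c + 2 * d + a + b - s)
  - (4 * d + 2 * a + b + c - s)); first by ring.
by rewrite Ea Eb Ec Ed; ring.
Qed.

(** A transposition acts by -1 and a 4-cycle, which is odd, acts trivially. *)
Lemma antisym_cyclic_eq0 {K : fieldType} (char0 : [pchar K] =i pred0)
  {T : Type} {M : lmodType K} (f : T -> T -> T -> T -> M) :
  (forall a b c d, f a b c d = - f b a c d) ->
  (forall a b c d, f a b c d = f b c d a) ->
  forall a b c d, f a b c d = 0.
Proof.
move=> anti cyc a b c d.
have swap23 x y z t : f x y z t = - f x z y t.
  by rewrite cyc anti -cyc.
have swap34 x y z t : f x y z t = - f x y t z.
  by rewrite cyc swap23 -cyc.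
have fN : f a b c d = - f a b c d.
  by rewrite {1}cyc swap34 swap23 opprK anti.
have n2 : 2%:R != 0 :> K by rewrite ((pcharf0P K).1 char0).
move/eqP: fN; rewrite -subr_eq0 opprK -mulr2n -scaler_nat scaler_eq0.
by rewrite (negPf n2) => /eqP.
Qed.

Section InvariantForm.
Context {K : fieldType} (char0 : [pchar K] =i pred0).
Context {M : vectType K} (br : {bilinear M -> M -> M}) (form : {symmetric M}).
Hypothesis anti : forall u v, br u v = - br v u.
Hypothesis nd : nondegenerate form.
Hypothesis inv : forall u v w, form (br u v) w + form v (br u w) = 0.

Let formC u v : form u v = form v u.
Proof. by rewrite hermC /= expr0 mul1r. Qed.

Lemma form_ext x y : (forall t, form x t = form y t) -> x = y.
Proof.
move=> fxy; apply/eqP; rewrite -subr_eq0; apply/eqP.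
by apply: (nondegenerate_inj nd) => t; rewrite linearBl /= fxy subrr.
Qed.

Lemma form_brl u v w : form (br u v) w = - form v (br u w).
Proof. by apply/eqP; rewrite -addr_eq0 inv. Qed.

(** With antisymmetry, this makes <[u,v],w> an alternating trilinear map. *)
Lemma form_br_cycle u v w : form (br u v) w = form (br v w) u.
Proof. by rewrite anti linearNl /= form_brl opprK formC. Qed.

Lemma levi_civita_half_bracket u v :
  levi_civita br form u v = 2^-1 *: br u v.
Proof.
symmetry; apply: levi_civita_unique => // w.
have n2 : 2 != 0 :> K by rewrite ((pcharf0P K).1 char0).
rewrite linearZl_LR /= /GRing.scale /= mulrA divff // mul1r.
by rewrite (form_br_cycle u) subrr add0r (form_br_cycle v).
Qed.

(** The factor 8 clears the denominators, each L being half a bracket. *)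
Lemma curvature_words u v w z :
  8%:R *: curvature br form u v w z =
  4%:R *: br (br (br u v) w) z + 2%:R *: br (br (br v w) z) u
  + br (br (br w z) u) v + br (br (br z u) v) w
  - 2%:R *: br (br u w) (br v z).
Proof.
have n2 : 2 != 0 :> K by rewrite ((pcharf0P K).1 char0).
(* The left-hand sides are the products that occur in the curvature. *)
have vwzu : br u (br (br v w) z) = - br (br (br v w) z) u by exact: anti.
have wzuv : br v (br u (br w z)) = br (br (br w z) u) v.
  by rewrite anti (anti u) linearNl opprK.
have zuvw : br w (br v (br u z)) = - br (br (br z u) v) w.
  by rewrite anti (anti v) linearNl (anti u) !linearNl /= !opprK.
have LE x y : levi_civita_left br form x y = 2^-1 *: br x y.
  by rewrite levi_civita_leftE levi_civita_half_bracket.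
apply: form_ext => t; rewrite /curvature.
rewrite !(add_lfunE, opp_lfunE, comp_lfunE, LE).
rewrite !(linearZr_LR br) /= vwzu wzuv zuvw.
rewrite !(linearDl, linearBl, linearNl, linearZl_LR) /= /GRing.scale /=.
by field.
Qed.

(** Invariance moves the two brackets off z, at the cost of a word of length
    four in u, w, x, v, where x is the vector paired with the double bracket. *)
Lemma double_bracket_eq0 :
  three_step_nilpotent br -> forall u v w z, br (br u w) (br v z) = 0.
Proof.
move=> nil u v w z; apply: form_ext => x.
rewrite form_brl form_brl opprK (anti v) linearNr /=.
by rewrite nil linear0r oppr0 linear0l.
Qed.

(** The four cyclic shifts of [curvature_words] = 0 have the same right-hand
    side; paired with a vector t, they form a circulant system over K. *)
Lemma flat_word_cyclic : is_flat br form ->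
  forall u v w z, br (br (br u v) w) z = br (br (br v w) z) u.
Proof.
move=> flat u v w z; apply: form_ext => t.
have words a b c d : 4 * form (br (br (br a b) c) d) t
    + 2 * form (br (br (br b c) d) a) t + form (br (br (br c d) a) b) t
    + form (br (br (br d a) b) c) t - 2 * form (br (br a c) (br b d)) t = 0.
  have := congr1 (form^~ t) (curvature_words a b c d).
  rewrite /= flat lfunE /= scaler0 linear0l.
  by rewrite !(linearDl, linearBl, linearNl, linearZl_LR) /= /GRing.scale /=.
have shift a b c d : br (br b d) (br c a) = br (br a c) (br b d).
  by rewrite anti (anti c) linearNl opprK.
apply: (circulant_eq char0 _ _ _ _ (2 * form (br (br u w) (br v z)) t)).
- exact: words.
- by have := words v w z u; rewrite shift.
- by have := words w z u v; rewrite 2!shift.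
- by have := words z u v w; rewrite 3!shift.
Qed.

Lemma flat_three_step_nilpotent : is_flat br form <-> three_step_nilpotent br.
Proof.
split=> [flat | nil u v w].
  apply: antisym_cyclic_eq0 => // [u v w z|]; last exact: flat_word_cyclic.
  by rewrite (anti u) !linearNl.
apply/lfunP=> z; rewrite [RHS]lfunE /=; apply/eqP.
have n8 : 8%:R != 0 :> K by rewrite ((pcharf0P K).1 char0).
rewrite -(inj_eq (scalerI n8)) curvature_words !nil double_bracket_eq0 //.
by rewrite !scaler0 !addr0 subr0.
Qed.

End InvariantForm.

Theorem proposition2p16 (K : fieldType) (char0 : [pchar K] =i pred0)
  (M : vectType K) (br : {bilinear M -> M -> M}) (form : {symmetric M}) :
  is_quadratic_malcev br form ->
  is_flat br form <-> three_step_nilpotent br.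
Proof. by case=> -[anti _] nd inv; exact: flat_three_step_nilpotent. Qed.
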